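(* Let $G$ be a finitely generated group hyperbolic relative to a finite collection $\mathcal P=\{P_\lambda\}_{\lambda\in\Lambda}$, and $S$ a finite generating set. Then for all sufficiently large $n$, every finite subgroup $F\le G$ fixes a clique of the $n$-Rips graph $\Gamma_n$, i.e. there is a nonempty clique of $\Gamma_n$ that is mapped to itself by every element of $F$.
   Context: Let $\Gamma$ be the Cayley graph of $G$ with respect to $S$, $V=G$, $W$ the set of cosets $gP_\lambda$. Relative hyperbolicity means the coned-off Cayley graph (vertex set $V\cup W$, edges of $\Gamma$ plus an edge $(v,w)$ whenever $v\in w$) is fine and $\delta$-hyperbolic. Extend $|\cdot,\cdot|_S$ to $V\cup W$ via distances in $\Gamma$ between the corresponding elements/cosets. $\Gamma_n$ has vertex set $V\cup W$, an edge between $u\ne u'$ whenever $|u,u'|_S\le n$, and $G$ acts by left multiplication. *)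

(* Defs.v *)
From Stdlib Require Import List Arith Lia.
Import ListNotations.

Set Implicit Arguments.

Record Group := {
  gcar :> Type;
  gmul : gcar -> gcar -> gcar;
  ginv : gcar -> gcar;
  gone : gcar;
  gmulA : forall x y z, gmul x (gmul y z) = gmul (gmul x y) z;
  gmul1l : forall x, gmul gone x = x;
  gmul1r : forall x, gmul x gone = x;
  gmulVl : forall x, gmul (ginv x) x = gone;
  gmulVr : forall x, gmul x (ginv x) = gone
}.

Arguments gmul {g} _ _.
Arguments ginv {g} _.

Section Defs.
Variable G : Group.

Definition gprod (w : list G) : G := fold_right (@gmul G) (@gone G) w.

Definition is_subgroup (H : G -> Prop) : Prop :=
  H (@gone G) /\ (forall x y, H x -> H y -> H (gmul x y)) /\
  (forall x, H x -> H (ginv x)).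

Definition finite_pred (H : G -> Prop) : Prop :=
  exists l : list G, forall x, H x -> In x l.

Definition letter (S : list G) (s : G) : Prop := In s S \/ In (ginv s) S.

Definition generates (S : list G) : Prop :=
  forall g : G, exists w, Forall (letter S) w /\ gprod w = g.

Definition dS_le (S : list G) (g h : G) (n : nat) : Prop :=
  exists w, Forall (letter S) w /\ length w <= n /\ gmul g (gprod w) = h.

Variable Lam : Type.
Variable P : Lam -> G -> Prop.

Definition coset (g : G) (l : Lam) : G -> Prop := fun x => P l (gmul (ginv g) x).

(** vertices of V ∪ W: group elements, and cosets tagged by their λ *)
Inductive vtx : Type :=
| VV : G -> vtx
| VW : Lam -> (G -> Prop) -> vtx.

Definition valid (v : vtx) : Prop :=
  match v with
  | VV _ => True
  | VW l C => exists g, C = coset g l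
  end.

Definition vmem (v : vtx) (x : G) : Prop :=
  match v with
  | VV g => x = g
  | VW _ C => C x
  end.

Definition act (f : G) (v : vtx) : vtx :=
  match v with
  | VV g => VV (gmul f g)
  | VW l C => VW l (fun y => C (gmul (ginv f) y))
  end.

Definition distS_le (S : list G) (u u' : vtx) (n : nat) : Prop :=
  exists x y, vmem u x /\ vmem u' y /\ dS_le S x y n.

Definition rips_adj (S : list G) (n : nat) (u u' : vtx) : Prop :=
  valid u /\ valid u' /\ u <> u' /\ distS_le S u u' n.

Definition cadj (S : list G) (u v : vtx) : Prop :=
  valid u /\ valid v /\ u <> v /\
  match u, v with
  | VV g, VV h => exists s, In s S /\ (h = gmul g s \/ g = gmul h s)
  | VV g, VW _ C => C g
  | VW _ C, VV g => C g
  | VW _ _, VW _ _ => False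
  end.

Inductive walk (Sg : list G) : vtx -> vtx -> nat -> Prop :=
| walk0 u : valid u -> walk Sg u u 0
| walkS u v w k : cadj Sg u v -> walk Sg v w k -> walk Sg u w (Datatypes.S k).

Definition cdist (S : list G) (u v : vtx) (k : nat) : Prop :=
  walk S u v k /\ forall k', walk S u v k' -> k <= k'.

(** δ-hyperbolicity (Gromov four-point condition) of the coned-off graph *)
Definition coned_hyperbolic (S : list G) : Prop :=
  exists delta : nat, forall x y z w dxy dzw dxz dyw dxw dyz,
    cdist S x y dxy -> cdist S z w dzw -> cdist S x z dxz ->
    cdist S y w dyw -> cdist S x w dxw -> cdist S y z dyz ->
    dxy + dzw <= Nat.max (dxz + dyw) (dxw + dyz) + 2 * delta.

Fixpoint chain (S : list G) (l : list vtx) : Prop :=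
  match l with
  | x :: ((y :: _) as t) => cadj S x y /\ chain S t
  | _ => True
  end.

Definition circuit (S : list G) (c : list vtx) : Prop :=
  3 <= length c /\ NoDup c /\ chain S c /\
  match c with
  | x :: _ => cadj S (last c x) x
  | [] => False
  end.

(** fineness (Bowditch): each edge lies in finitely many circuits of each length.
    A circuit through the edge {a,b} is represented by its vertex sequence
    starting a, b, ... *)
Definition coned_fine (S : list G) : Prop :=
  forall a b, cadj S a b -> forall n, exists L : list (list vtx),
    forall rest, circuit S (a :: b :: rest) -> length rest + 2 = n ->
      In (a :: b :: rest) L.

Definition rel_hyperbolic (S : list G) : Prop :=
  (forall l, is_subgroup (P l)) /\ coned_fine S /\ coned_hyperbolic S.

Definition rips_clique (S : list G) (n : nat) (K : list vtx) : Prop :=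
  K <> [] /\ (forall u, In u K -> valid u) /\
  (forall u u', In u K -> In u' K -> u <> u' -> rips_adj S n u u').

Definition fixes_set (F : G -> Prop) (K : list vtx) : Prop :=
  forall f, F f -> forall v, In v K <-> In (act f v) K.

End Defs.

(* Main.v *)
(** Let [X] be the [F]-orbit of the identity in the coned-off graph, let [r] be
    the least radius of a ball containing [X], and call the centres of such balls
    of radius [r] the centres of [X].  The four-point condition bounds the
    diameter of the [F]-invariant set of centres by [4 delta + 1].

    Let [c], [c'] be centres and let [p, w, q] be consecutive on a geodesic from
    [c] to [c'], where [w] is a coset.  If every short walk from [p] to [q] went
    through [w], then for each [x] in [X] some geodesic from [c] or from [c'] to
    [x] would go through [w], since the two geodesics fellow-travel and would
    otherwise provide a short detour around [w].  Then [w] would be at distance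
    less than [r] from all of [X], contradicting the choice of [r].  Hence [p]
    and [q] are joined by a short walk avoiding [w]; fineness and the finiteness
    of the number of edge orbits bound [|p, q|_S].  Summing along the geodesic
    bounds [|c, c'|_S], so the [F]-orbit of a centre is a clique. *)

Require Import Defs.
From Stdlib Require Import List Arith Lia.
From Stdlib Require Import Classical ClassicalEpsilon.
From Stdlib Require Import FunctionalExtensionality PropExtensionality.
Import ListNotations.

Arguments gone {g}.
Arguments VV {G Lam} _.
Arguments VW {G Lam} _ _.
Arguments walk0 {G Lam P Sg u} _.

(** * Least elements and uniform bounds over finite lists *)

Lemma least_nat (Q : nat -> Prop) :
  (exists n, Q n) -> exists n, Q n /\ forall m, Q m -> n <= m.
Proof.
  intros [n Hn]. revert Hn.
  induction n as [n IH] using (well_founded_induction lt_wf). intros Hn.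
  destruct (classic (exists m, m < n /\ Q m)) as [[m [Hm Qm]]|H].
  - exact (IH m Hm Qm).
  - exists n; split; [exact Hn|]. intros m Qm.
    destruct (le_lt_dec n m) as [|Hl]; [assumption|].
    exfalso; apply H; exists m; auto.
Qed.

Lemma sublist_of_pred (A : Type) (Q : A -> Prop) (L : list A) :
  exists L', forall x, In x L' <-> In x L /\ Q x.
Proof.
  induction L as [|a L [L' IH]].
  - exists []; simpl; tauto.
  - destruct (classic (Q a)) as [Ha|Ha].
    + exists (a :: L'); intros x; simpl; rewrite IH.
      split; [intros [->|]|]; tauto.
    + exists L'; intros x; simpl; rewrite IH.
      split; [|intros [[->|] ?]]; tauto.
Qed.

Lemma uniform_bound_list (A : Type) (Q : A -> nat -> Prop) (L : list A) :
  (forall a m n, Q a m -> m <= n -> Q a n) ->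
  (forall a, In a L -> exists n, Q a n) ->
  exists n, forall a, In a L -> Q a n.
Proof.
  intros Hmono. induction L as [|a L IH]; intros H.
  - exists 0; intros a [].
  - destruct (H a (or_introl eq_refl)) as [m Hm].
    destruct IH as [n Hn]; [intros b Hb; apply H; right; exact Hb|].
    exists (m + n); intros b [<-|Hb].
    + apply Hmono with m; [exact Hm|lia].
    + apply Hmono with n; [exact (Hn b Hb)|lia].
Qed.

(** * Group identities and the word metric *)

Section GroupFacts.
Context {G : Group}.
Implicit Types f g h x y : G.

Lemma gmulKl f x : gmul (ginv f) (gmul f x) = x.
Proof. now rewrite gmulA, gmulVl, gmul1l. Qed.

Lemma gmulKr f x : gmul f (gmul (ginv f) x) = x.
Proof. now rewrite gmulA, gmulVr, gmul1l. Qed.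

Lemma ginv_unique x y : gmul x y = gone -> ginv x = y.
Proof. intros H. now rewrite <- (gmulKl x y), H, gmul1r. Qed.

Lemma ginvK x : ginv (ginv x) = x.
Proof. apply ginv_unique, gmulVl. Qed.

Lemma ginv1 : ginv (@gone G) = gone.
Proof. apply ginv_unique, gmul1l. Qed.

Lemma ginvM x y : ginv (gmul x y) = gmul (ginv y) (ginv x).
Proof. apply ginv_unique. now rewrite <- gmulA, gmulKr, gmulVr. Qed.

Lemma gprod_app (w w' : list G) : gprod G (w ++ w') = gmul (gprod G w) (gprod G w').
Proof.
  induction w as [|a w IH]; simpl.
  - now rewrite gmul1l.
  - unfold gprod in *. now rewrite IH, gmulA.
Qed.

Variable gens : list G.

Lemma dS_le_refl g n : dS_le G gens g g n.
Proof.
  exists []. split; [constructor|]. split; [simpl; lia|]. apply gmul1r.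
Qed.

Lemma dS_le_mono g h m n : dS_le G gens g h m -> m <= n -> dS_le G gens g h n.
Proof. intros [w [Hw [Hl He]]] Hmn. exists w; repeat split; auto; lia. Qed.

Lemma dS_le_trans g h x m n :
  dS_le G gens g h m -> dS_le G gens h x n -> dS_le G gens g x (m + n).
Proof.
  intros [w [Hw [Hl He]]] [w' [Hw' [Hl' He']]]. exists (w ++ w'). split.
  - now apply Forall_app.
  - split; [rewrite length_app; lia|]. now rewrite gprod_app, gmulA, He.
Qed.

Lemma dS_le_act f g h n :
  dS_le G gens g h n -> dS_le G gens (gmul f g) (gmul f h) n.
Proof.
  intros [w [Hw [Hl He]]]. exists w; repeat split; auto. now rewrite <- gmulA, He.
Qed.

Lemma dS_le_letter g s : letter G gens s -> dS_le G gens g (gmul g s) 1.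
Proof.
  intros Hs. exists [s]. split; [now constructor|]. split; [simpl; lia|].
  simpl. now rewrite gmul1r.
Qed.

Lemma dS_le_exists g h : generates G gens -> exists n, dS_le G gens g h n.
Proof.
  intros H. destruct (H (gmul (ginv g) h)) as [w [Hw He]].
  exists (length w), w. repeat split; auto. rewrite He. apply gmulKr.
Qed.

End GroupFacts.

(** * The action of [G] on the vertices and edges of the coned-off graph *)

Section ConedOff.
Context {G : Group} {Lam : Type} {P : Lam -> G -> Prop} {gens : list G}.
Implicit Types (f g h : G) (u v w : vtx G Lam) (l : Lam).
Hypothesis HP : forall l, is_subgroup G (P l).
Hypothesis HS : generates G gens.

Local Notation Valid := (@valid G Lam P).
Local Notation adj := (@cadj G Lam P gens).
Local Notation walk := (@walk G Lam P gens).
Local Notation cdist := (@cdist G Lam P gens).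

Lemma act_act f g v : act f (act g v) = act (gmul f g) v.
Proof.
  destruct v as [h|l C]; simpl.
  - now rewrite gmulA.
  - f_equal. extensionality y. now rewrite ginvM, gmulA.
Qed.

Lemma act_one v : act gone v = v.
Proof.
  destruct v as [h|l C]; simpl.
  - now rewrite gmul1l.
  - f_equal. extensionality y. now rewrite ginv1, gmul1l.
Qed.

Lemma actK f v : act (ginv f) (act f v) = v.
Proof. now rewrite act_act, gmulVl, act_one. Qed.

Lemma actKV f v : act f (act (ginv f) v) = v.
Proof. now rewrite act_act, gmulVr, act_one. Qed.

Lemma act_coset f g l : act f (VW l (coset G P g l)) = VW l (coset G P (gmul f g) l).
Proof.
  simpl. f_equal. extensionality y. unfold coset. now rewrite ginvM, gmulA.
Qed.

Lemma coset_self g l : coset G P g l g.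
Proof. unfold coset. rewrite gmulVl. apply HP. Qed.

(** Lets a coset be based at any chosen member, so that an edge between a coset and a group element
    can be translated to one at the identity. *)
Lemma coset_eq g h l : coset G P g l h -> coset G P g l = coset G P h l.
Proof.
  intros H. destruct (HP l) as [_ [HM HV]]. unfold coset in *.
  extensionality y. apply propositional_extensionality; split; intros Hy.
  - replace (gmul (ginv h) y) with (gmul (ginv (gmul (ginv g) h)) (gmul (ginv g) y)).
    + auto.
    + now rewrite ginvM, ginvK, <- gmulA, gmulKr.
  - replace (gmul (ginv g) y) with (gmul (gmul (ginv g) h) (gmul (ginv h) y)).
    + auto.
    + now rewrite <- gmulA, gmulKr.
Qed.

Lemma valid_act f v : Valid v -> Valid (act f v).
Proof.
  destruct v as [h|l C]; [exact id|]. intros [g ->].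
  rewrite act_coset. now exists (gmul f g).
Qed.

Lemma cadj_sym u v : adj u v -> adj v u.
Proof.
  intros [Hu [Hv [Hne H]]]. split; [exact Hv|]. split; [exact Hu|].
  split; [congruence|].
  destruct u, v; try exact H. destruct H as [s [Hs H]]. exists s; tauto.
Qed.

Lemma cadj_act f u v : adj u v -> adj (act f u) (act f v).
Proof.
  intros [Hu [Hv [Hne H]]].
  split; [now apply valid_act|]. split; [now apply valid_act|]. split.
  - intros E. apply Hne. rewrite <- (actK f u), <- (actK f v). now rewrite E.
  - destruct u, v; simpl in *; rewrite ?gmulKl; try exact H.
    destruct H as [s [Hs H]]. exists s. split; [exact Hs|].
    destruct H as [->| ->]; [left|right]; apply gmulA.
Qed.

(** * Walks, connectivity and the graph distance *)

Lemma walk_valid u v k : walk u v k -> Valid u /\ Valid v.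
Proof.
  induction 1 as [u Hu|u v w k Huv _ [_ Hw]]; [auto|].
  split; [apply Huv|exact Hw].
Qed.

Lemma walk_trans u v w i j : walk u v i -> walk v w j -> walk u w (i + j).
Proof.
  induction 1 as [|u v' v k Huv _ IH]; simpl; [auto|].
  intros H. eapply walkS; eauto.
Qed.

Lemma walk_step u v : adj u v -> walk u v 1.
Proof. intros H. apply walkS with v; [exact H|]. apply walk0, H. Qed.

Lemma walk_sym u v k : walk u v k -> walk v u k.
Proof.
  induction 1 as [u Hu|u v w k Huv _ IH]; [now apply walk0|].
  replace (S k) with (k + 1) by lia.
  eapply walk_trans; [exact IH|]. now apply walk_step, cadj_sym.
Qed.

Lemma walk_act f u v k : walk u v k -> walk (act f u) (act f v) k.
Proof.
  induction 1 as [u Hu|u v w k Huv _ IH].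
  - now apply walk0, valid_act.
  - eapply walkS; [apply cadj_act|]; eauto.
Qed.

Lemma walk_split u v i j : walk u v (i + j) -> exists a, walk u a i /\ walk a v j.
Proof.
  revert u. induction i as [|i IH]; simpl; intros u H.
  - exists u; split; [apply walk0, (walk_valid _ _ _ H)|exact H].
  - inversion H as [|u' u1 v' k' Ha Hw]; subst.
    destruct (IH _ Hw) as [a [H1 H2]].
    exists a; split; [eapply walkS; eauto|exact H2].
Qed.

Lemma walk_group g h : exists k, walk (VV g) (VV h) k.
Proof.
  destruct (HS (gmul (ginv g) h)) as [s [Hs He]].
  assert (Hh : h = gmul g (gprod G s)) by now rewrite He, gmulKr.
  subst h. clear He. revert g. induction Hs as [|a s Ha Hs IH]; intros g; simpl.
  - exists 0. rewrite gmul1r. now apply walk0.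
  - rewrite gmulA. destruct (IH (gmul g a)) as [k Hk].
    (* A letter may be trivial in [G], while [cadj] admits no loops; such a letter contributes no
       step. *)
    destruct (classic (gmul g a = g)) as [E|E].
    + exists k. now rewrite E in *.
    + exists (S k). eapply walkS; [|exact Hk].
      repeat split; [congruence|]. destruct Ha as [Ha|Ha].
      * exists a; auto.
      * exists (ginv a); split; [exact Ha|right].
        now rewrite <- gmulA, gmulVr, gmul1r.
Qed.

Lemma walk_to_group u : Valid u -> exists g k, walk u (VV g) k.
Proof.
  destruct u as [g|l C]; intros Hu.
  - exists g, 0. now apply walk0.
  - destruct Hu as [g ->]. exists g, 1. apply walk_step.
    repeat split; [now exists g|congruence|apply coset_self].
Qed.

Lemma walk_exists u v : Valid u -> Valid v -> exists k, walk u v k.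
Proof.
  intros Hu Hv. destruct (walk_to_group u Hu) as [g [i Hi]].
  destruct (walk_to_group v Hv) as [h [j Hj]].
  destruct (walk_group g h) as [k Hk]. exists (i + (k + j)).
  eapply walk_trans; [exact Hi|]. eapply walk_trans; [exact Hk|]. now apply walk_sym.
Qed.

(* Meaningful only between valid vertices, where [cdist u v] has a witness. *)
Definition dist u v : nat := epsilon (inhabits 0) (fun k => cdist u v k).

Lemma cdist_dist u v : Valid u -> Valid v -> cdist u v (dist u v).
Proof.
  intros Hu Hv. unfold dist. apply epsilon_spec.
  exact (least_nat _ (walk_exists u v Hu Hv)).
Qed.

Lemma walk_dist u v : Valid u -> Valid v -> walk u v (dist u v).
Proof. intros Hu Hv. now apply cdist_dist. Qed.

Lemma dist_le u v k : walk u v k -> dist u v <= k.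
Proof. intros H. destruct (walk_valid _ _ _ H). now apply cdist_dist. Qed.

Lemma dist_triangle u v w :
  Valid u -> Valid v -> Valid w -> dist u w <= dist u v + dist v w.
Proof.
  intros. apply dist_le. eapply walk_trans; apply walk_dist; auto.
Qed.

Lemma dist_sym u v : Valid u -> Valid v -> dist u v = dist v u.
Proof.
  intros. apply Nat.le_antisymm; apply dist_le, walk_sym, walk_dist; auto.
Qed.

Lemma dist_adj u v : adj u v -> dist u v <= 1.
Proof. intros H. now apply dist_le, walk_step. Qed.

Lemma dist_act_le f u v : Valid u -> Valid v -> dist (act f u) (act f v) <= dist u v.
Proof. intros. apply dist_le, walk_act, walk_dist; auto. Qed.

Lemma geodesic_point u v t : Valid u -> Valid v -> t <= dist u v ->
  exists a, Valid a /\ dist u a = t /\ t + dist a v = dist u v.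
Proof.
  intros Hu Hv Ht. pose proof (walk_dist u v Hu Hv) as W.
  replace (dist u v) with (t + (dist u v - t)) in W by lia.
  apply walk_split in W. destruct W as [a [H1 H2]].
  assert (Ha : Valid a) by apply (walk_valid _ _ _ H2).
  pose proof (dist_le _ _ _ H1). pose proof (dist_le _ _ _ H2).
  pose proof (dist_triangle u a v Hu Ha Hv).
  exists a; repeat split; auto; lia.
Qed.

Lemma geodesic_step u v : Valid u -> Valid v -> u <> v ->
  exists a, adj u a /\ 1 + dist a v = dist u v.
Proof.
  intros Hu Hv Hne. pose proof (walk_dist u v Hu Hv) as W.
  inversion W as [|u' a v' k Ha Hw E1 E2 E3]; subst; [congruence|].
  exists a. split; [exact Ha|]. pose proof (dist_le _ _ _ Hw).
  assert (Hva : Valid a) by apply Ha.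
  pose proof (dist_adj _ _ Ha). pose proof (dist_triangle u a v Hu Hva Hv). lia.
Qed.

(** * Walks avoiding a vertex *)

Inductive avoiding_walk (w : vtx G Lam) : vtx G Lam -> vtx G Lam -> nat -> Prop :=
| avoiding_walk0 u : Valid u -> u <> w -> avoiding_walk w u u 0
| avoiding_walkS u v z k : u <> w -> adj u v -> avoiding_walk w v z k ->
    avoiding_walk w u z (S k).

Lemma avoiding_walk_trans w u v z i j :
  avoiding_walk w u v i -> avoiding_walk w v z j -> avoiding_walk w u z (i + j).
Proof.
  induction 1 as [|u v' v k Hu Huv _ IH]; simpl; [auto|].
  intros H. eapply avoiding_walkS; eauto.
Qed.

Lemma avoiding_walk_act f w u v k :
  avoiding_walk w u v k -> avoiding_walk (act f w) (act f u) (act f v) k.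
Proof.
  assert (Hinj : forall x y : vtx G Lam, x <> y -> act f x <> act f y).
  { intros x y Hne E. apply Hne. rewrite <- (actK f x), E. apply actK. }
  induction 1 as [u Hu Hne|u v z k Hne Huv _ IH].
  - apply avoiding_walk0; [now apply valid_act|auto].
  - eapply avoiding_walkS; [auto|now apply cadj_act, Huv|exact IH].
Qed.

Lemma walk_avoids_or_passes w u v k : walk u v k ->
  avoiding_walk w u v k \/ exists i j, i + j = k /\ walk u w i /\ walk w v j.
Proof.
  induction 1 as [u Hu|u v z k Huv Hvz IH].
  - destruct (classic (u = w)) as [<-|Hne].
    + right; exists 0, 0; repeat split; now apply walk0.
    + left; now apply avoiding_walk0.
  - destruct (classic (u = w)) as [<-|Hne].
    + right; exists 0, (S k). repeat split; [apply walk0, Huv|eapply walkS; eauto].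
    + destruct IH as [IH|[i [j [E [H1 H2]]]]].
      * left; eapply avoiding_walkS; eauto.
      * right; exists (S i), j. repeat split; [lia|eapply walkS; eauto|exact H2].
Qed.

(** One fixed geodesic is inspected. In the second alternative [w] lies on it, and later arguments
    refute this by comparing distances. *)
Lemma geodesic_avoids_or_passes w u v : Valid u -> Valid v ->
  avoiding_walk w u v (dist u v) \/ dist u w + dist w v <= dist u v.
Proof.
  intros Hu Hv.
  destruct (walk_avoids_or_passes w u v _ (walk_dist u v Hu Hv)) as [H|H]; [auto|].
  destruct H as [i [j [E [H1 H2]]]]. right.
  pose proof (dist_le _ _ _ H1). pose proof (dist_le _ _ _ H2). lia.
Qed.

Lemma chain_suffix (l1 l2 : list (vtx G Lam)) :
  chain P gens (l1 ++ l2) -> chain P gens l2.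
Proof.
  induction l1 as [|a l1 IH]; [auto|]. intros H. apply IH.
  change (chain P gens (a :: (l1 ++ l2))) in H.
  destruct (l1 ++ l2); [exact I|]. apply H.
Qed.

Lemma last_suffix (A : Type) (l1 l2 : list A) a d :
  last (l1 ++ a :: l2) d = last (a :: l2) d.
Proof.
  induction l1 as [|b l1 IH]; [reflexivity|]. rewrite <- IH.
  destruct l1; reflexivity.
Qed.

(** Loop erasure: if [u] recurs on the path already built for the tail, everything before the
    recurrence is dropped. The default [w] of [last] is never returned, because the list is
    nonempty. *)
Lemma avoiding_walk_path w u v k : avoiding_walk w u v k ->
  exists rest, chain P gens (u :: rest) /\ last (u :: rest) w = v /\ length rest <= k /\
    ~ In w (u :: rest) /\ NoDup (u :: rest).
Proof.
  induction 1 as [u Hu Hne|u v z k Hne Huv _ IH].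
  - exists []. repeat split; simpl; auto; [tauto|repeat constructor; auto].
  - destruct IH as [rest [Hc [Hl [Hk [Hw Hd]]]]].
    destruct (classic (In u (v :: rest))) as [Hin|Hin].
    + apply in_split in Hin. destruct Hin as [l1 [l2 E]].
      assert (Hlen : length (v :: rest) = length (l1 ++ u :: l2)) by now rewrite E.
      rewrite length_app in Hlen. simpl in Hlen.
      rewrite E in Hc, Hl, Hw, Hd. exists l2. repeat split.
      * now apply chain_suffix with l1.
      * now rewrite <- Hl, last_suffix.
      * lia.
      * intros H; apply Hw, in_or_app; auto.
      * eapply NoDup_app_remove_l; exact Hd.
    + exists (v :: rest). split; [split; [exact Huv|exact Hc]|]. repeat split.
      * exact Hl.
      * simpl; lia.
      * intros [->|H]; auto.
      * now constructor.
Qed.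

(** The loop-erased path misses [w], so prepending [w] keeps the vertices distinct and closes the
    path up. This turns a short detour into a circuit through the edge from [w] to [p], to which
    fineness applies. *)
Lemma avoiding_walk_circuit w p q k :
  adj w p -> adj q w -> p <> q -> avoiding_walk w p q k ->
  exists rest, circuit P gens (w :: p :: rest) /\ length rest <= k /\
    last (w :: p :: rest) w = q.
Proof.
  intros Hwp Hqw Hne H.
  destruct (avoiding_walk_path _ _ _ _ H) as [rest [Hc [Hl [Hk [Hw Hd]]]]].
  assert (HL : last (w :: p :: rest) w = q) by exact Hl.
  exists rest. split; [|auto]. unfold circuit. rewrite HL.
  split; [|split; [|split]].
  (* An empty [rest] would force [p = q]; hence there are at least three vertices. *)
  - destruct rest; [simpl in Hl; congruence|simpl; lia].
  - now constructor.
  - split; [exact Hwp|exact Hc].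
  - exact Hqw.
Qed.

(** * Bounded angles at cosets *)

(** A short detour from the identity to [h] around the coset closes to a circuit of bounded length
    through one fixed edge. Fineness lists these circuits, and [h] is the last vertex of one of
    them, so only finitely many [h] occur. *)
Lemma angle_bound_at_one (Hfine : coned_fine G P gens) (M : nat) l :
  exists B, forall h k, coset G P gone l h -> k <= M ->
    avoiding_walk (VW l (coset G P gone l)) (VV gone) (VV h) k ->
    dS_le G gens gone h B.
Proof.
  set (w := VW l (coset G P gone l)).
  assert (Hw : adj w (VV gone)).
  { repeat split; [now exists gone|discriminate|apply coset_self]. }
  (* Here [n] is [length rest + 2], the length of the circuit; it is at most [M + 2], whence the
     range [seq 0 (M + 3)]. *)
  destruct (uniform_bound_list nat
    (fun n B => forall rest h, circuit P gens (w :: VV gone :: rest) ->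
       length rest + 2 = n -> last (w :: VV gone :: rest) w = VV h ->
       dS_le G gens gone h B) (seq 0 (M + 3))) as [B HB].
  - intros n B B' H HBB rest h Hc Hn Hl.
    apply dS_le_mono with B; eauto.
  - intros n _. destruct (Hfine _ _ Hw n) as [L HL].
    destruct (uniform_bound_list (list (vtx G Lam))
      (fun c B => forall h, last c w = VV h -> dS_le G gens gone h B) L) as [B HB].
    + intros c B B' H HBB h Hh. apply dS_le_mono with B; auto.
    + intros c _. destruct (last c w) as [h|l' C].
      * destruct (dS_le_exists gens gone h HS) as [B HB].
        exists B. intros h' E. injection E as <-. exact HB.
      * exists 0; discriminate.
    + exists B. intros rest h Hc Hn Hl. exact (HB _ (HL rest Hc Hn) h Hl).
  - exists B. intros h k Hh Hk Hwalk.
    destruct (classic (VV (Lam := Lam) gone = VV h)) as [E|Hne].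
    + injection E as <-. apply dS_le_refl.
    + destruct (avoiding_walk_circuit w (VV gone) (VV h) k) as [rest [Hc [Hl He]]]; auto.
      { repeat split; [now exists gone|discriminate|exact Hh]. }
      apply (HB (length rest + 2)) with rest; auto. apply in_seq. lia.
Qed.

(** Translation by [ginv g] carries the edge between [g] and its coset to the edge between the
    identity and the subgroup [P l]. Thus there is one case for each of the finitely many [l], and a
    common bound exists. *)
Lemma angle_bound (Hfine : coned_fine G P gens)
  (HLam : exists lams : list Lam, forall l, In l lams) (M : nat) :
  exists B, forall l C g h k, Valid (VW l C) -> C g -> C h -> k <= M ->
    avoiding_walk (VW l C) (VV g) (VV h) k -> dS_le G gens g h B.
Proof.
  destruct HLam as [lams Hlams].
  destruct (uniform_bound_list Lam
    (fun l B => forall h k, coset G P gone l h -> k <= M ->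
      avoiding_walk (VW l (coset G P gone l)) (VV gone) (VV h) k ->
      dS_le G gens gone h B) lams) as [B HB].
  - intros l B B' H HBB h k H1 H2 H3. apply dS_le_mono with B; eauto.
  - intros l _. now apply angle_bound_at_one.
  - exists B. intros l C g h k [g0 ->] Hg Hh Hk Hw.
    rewrite (coset_eq _ _ _ Hg) in *.
    apply (avoiding_walk_act (ginv g)) in Hw.
    rewrite act_coset in Hw. simpl in Hw. rewrite gmulVl in Hw.
    assert (Hgh : dS_le G gens gone (gmul (ginv g) h) B).
    { apply (HB l (Hlams l) _ k); auto.
      unfold coset in *. now rewrite ginv1, gmul1l. }
    apply (dS_le_act gens g) in Hgh. now rewrite gmul1r, gmulKr in Hgh.
Qed.

(** * Centres of a bounded set *)

Section Centres.
Variable delta : nat.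
Hypothesis four_point : forall x y z w dxy dzw dxz dyw dxw dyz,
    cdist x y dxy -> cdist z w dzw -> cdist x z dxz ->
    cdist y w dyw -> cdist x w dxw -> cdist y z dyz ->
    dxy + dzw <= Nat.max (dxz + dyw) (dxw + dyz) + 2 * delta.

Lemma four_point_dist x y z w : Valid x -> Valid y -> Valid z -> Valid w ->
  dist x y + dist z w <=
    Nat.max (dist x z + dist y w) (dist x w + dist y z) + 2 * delta.
Proof. intros. eapply four_point; apply cdist_dist; auto. Qed.

Variable X : vtx G Lam -> Prop.
Hypothesis X_nonempty : exists x, X x.
Hypothesis X_valid : forall x, X x -> Valid x.
Variable r : nat.
Hypothesis r_min : forall c k, Valid c -> (forall x, X x -> dist c x <= k) -> r <= k.

Definition centre c := Valid c /\ forall x, X x -> dist c x <= r.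

(** If two centres were further apart, the midpoint [m] of a geodesic between them would be closer
    than [r] to all of [X]: the four-point condition on [m], [x], [c], [c'] saves half of
    [dist c c'] at a cost of [2 delta]. *)
Lemma centre_diameter c c' : centre c -> centre c' -> dist c c' <= 4 * delta + 1.
Proof.
  intros [Hc Xc] [Hc' Xc'].
  destruct (geodesic_point c c' (dist c c' / 2)) as [m [Hm [E1 E2]]]; auto.
  { apply Nat.Div0.div_le_upper_bound; lia. }
  pose proof (Nat.div_mod_eq (dist c c') 2).
  pose proof (Nat.mod_upper_bound (dist c c') 2 ltac:(lia)).
  set (t := dist c c' / 2) in *.
  destruct (le_lt_dec (dist c c') (4 * delta + 1)) as [|Hlt]; [assumption|].
  assert (Hm_dist : forall x, X x -> dist m x + t <= r + 2 * delta).
  { intros x Hx. pose proof (X_valid x Hx) as Vx.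
    pose proof (four_point_dist m x c c' Hm Vx Hc Hc').
    pose proof (Xc x Hx). pose proof (Xc' x Hx).
    rewrite (dist_sym m c), (dist_sym x c), (dist_sym x c') in * by auto. lia. }
  (* A point of [X] yields [t <= r + 2 * delta], so the truncated subtraction below is exact and
     strictly less than [r]. *)
  destruct X_nonempty as [x0 Hx0]. pose proof (Hm_dist x0 Hx0).
  assert (r <= r + 2 * delta - t); [|lia].
  apply (r_min m); [exact Hm|]. intros x Hx. pose proof (Hm_dist x Hx). lia.
Qed.

Lemma detour_around_coset c c' p w q :
  let D := 4 * delta + 1 in
  centre c -> centre c' -> adj p w -> adj w q ->
  dist c p < dist c w -> dist q c' < dist w c' ->
  dist c w + dist w c' = dist c c' ->
  exists k, k <= 9 * D + 4 * delta + 2 /\ avoiding_walk w p q k.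
Proof.
  intros D Cc Cc' Hpw Hwq Hp Hq Hw.
  pose proof (centre_diameter c c' Cc Cc') as HD. fold D in HD.
  destruct Cc as [Hc Xc], Cc' as [Hc' Xc'].
  assert (Vp : Valid p) by apply Hpw. assert (Vw : Valid w) by apply Hpw.
  assert (Vq : Valid q) by apply Hwq.
  destruct (geodesic_avoids_or_passes w p c Vp Hc) as [Apc|Hbad];
    [|rewrite (dist_sym w c), (dist_sym p c) in Hbad by auto; lia].
  destruct (geodesic_avoids_or_passes w c' q Hc' Vq) as [Acq|Hbad];
    [|rewrite (dist_sym c' w), (dist_sym c' q) in Hbad by auto; lia].
  rewrite (dist_sym p c) in Apc by auto. rewrite (dist_sym c' q) in Acq by auto.
  apply NNPP. intros Hno.
  (* The legs from [p] to [c] and from [c'] to [q] avoid [w], as [p] and [q] are nearer to the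
     respective ends than [w], and their total length is at most [D]. Attaching them to such a walk
     would give the excluded detour. *)
  assert (Hno' : forall k, k <= 7 * D + 4 * delta + 2 -> ~ avoiding_walk w c c' k).
  { intros k Hk Hwalk. apply Hno. exists (dist c p + (k + dist q c')).
    split; [lia|]. eapply avoiding_walk_trans; [exact Apc|].
    eapply avoiding_walk_trans; eauto. }
  clear Hno Apc Acq.
  (* This contradicts the minimality of [r]; the conjunct [1 <= r] guards the truncated
     subtraction. *)
  assert (Hcloser : forall x, X x -> dist w x <= r - 1 /\ 1 <= r); cycle 1.
  { destruct X_nonempty as [x0 Hx0]. pose proof (Hcloser x0 Hx0).
    assert (r <= r - 1); [|lia].
    apply (r_min w); [exact Vw|]. intros x Hx. now apply Hcloser. }
  intros x Hx. pose proof (X_valid x Hx) as Vx.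
  pose proof (Xc x Hx). pose proof (Xc' x Hx).
  apply NNPP. intros Hfar.
  (* As [w] differs from both centres and is not closer than [r] to [x], no geodesic from [c] or
     [c'] to [x] can pass through [w]. *)
  assert (Hfar1 : dist c x < dist c w + dist w x) by lia.
  assert (Hfar2 : dist c' x < dist c' w + dist w x)
    by (rewrite (dist_sym c' w) by auto; lia).
  clear Hfar.
  assert (A1 : forall a, Valid a -> dist c a + dist a x = dist c x ->
            avoiding_walk w c a (dist c a)).
  { intros a Va Ha. destruct (geodesic_avoids_or_passes w c a) as [|Hb]; auto.
    pose proof (dist_triangle w a x Vw Va Vx). lia. }
  assert (A2 : forall b, Valid b -> dist c' b + dist b x = dist c' x ->
            avoiding_walk w b c' (dist c' b)).
  { intros b Vb Hb. rewrite (dist_sym c' b) by auto.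
    destruct (geodesic_avoids_or_passes w b c') as [|Hb']; auto.
    pose proof (dist_triangle w b x Vw Vb Vx).
    rewrite (dist_sym b c'), (dist_sym w c'), (dist_sym b w) in Hb' by auto. lia. }
  (* Started at distance [t] from [c], a geodesic of length at most [D + 2 delta]
     cannot reach [w]. *)
  set (t := 2 * D + 2 * delta + 1) in *.
  pose proof (dist_triangle c c' x Hc Hc' Vx).
  pose proof (dist_triangle c' c x Hc' Hc Vx).
  rewrite (dist_sym c' c) in * by auto.
  assert (dist_xx : dist x x = 0).
  { pose proof (dist_le x x 0 (walk0 Vx)). lia. }
  (* If [x] is near, the detour goes through [x] itself: its length is at most
     [(t + D) + (t + 2 D) = 7 D + 4 delta + 2]. Otherwise it crosses between the two geodesics at
     distance [t] from their origins. *)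
  destruct (le_lt_dec (dist c x) (t + D)) as [Hshort|Hlong].
  - apply (Hno' (dist c x + dist c' x)); [lia|].
    eapply avoiding_walk_trans; [apply A1|apply A2]; auto; lia.
  - destruct (geodesic_point c x t) as [a [Va [Ea Ea']]]; auto; [lia|].
    destruct (geodesic_point c' x t) as [b [Vb [Eb Eb']]]; auto; [lia|].
    (* Fellow-travelling: this gives [dist a b <= D + 2 delta]. The three legs then total at most
       [5 D + 6 delta + 2], which is within the allowance because [delta <= D]. *)
    pose proof (four_point_dist a b c x Va Vb Hc Vx).
    pose proof (dist_triangle b c' c Vb Hc' Hc).
    rewrite (dist_sym a c), (dist_sym b c), (dist_sym b c'), (dist_sym c' c) in * by auto.
    pose proof (dist_triangle c w a Hc Vw Va).
    destruct (geodesic_avoids_or_passes w a b) as [Aab|Hb]; auto.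
    + apply (Hno' (dist c a + (dist a b + dist c' b))); [lia|].
      eapply avoiding_walk_trans; [apply A1; auto; lia|].
      eapply avoiding_walk_trans; [exact Aab|apply A2; auto; lia].
    + rewrite (dist_sym a w) in Hb by auto. lia.
Qed.

(** Along a geodesic, an edge of the Cayley graph costs 1 in the word metric, and a passage through
    a coset, which uses two edges, costs at most [B] by the detour around it. Hence [B + 1] per edge
    suffices. *)
Lemma centre_distS_le (B : nat) c c' :
  (forall l C g h k, Valid (VW l C) -> C g -> C h ->
     k <= 9 * (4 * delta + 1) + 4 * delta + 2 ->
     avoiding_walk (VW l C) (VV g) (VV h) k -> dS_le G gens g h B) ->
  centre c -> centre c' -> c <> c' ->
  distS_le gens c c' ((4 * delta + 1) * (B + 1)).
Proof.
  intros HB Cc Cc' Hne.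
  pose proof (centre_diameter c c' Cc Cc') as HD.
  assert (Hc : Valid c) by apply Cc. assert (Hc' : Valid c') by apply Cc'.
  (* The second premise keeps [g] on a geodesic from [c] to [c']. The induction is strong because
     crossing a coset lowers [k] by two; if [c'] is a coset, the trace stops at the group element
     from which it is entered. *)
  assert (Hgeo : forall k g, dist (VV g) c' = k ->
            dist c (VV g) + k = dist c c' ->
            exists y, vmem c' y /\ dS_le G gens g y (k * (B + 1))).
  { intros k. induction k as [k IH] using (well_founded_induction lt_wf).
    intros g Hk Hg. assert (Vg : Valid (VV g)) by exact I.
    destruct (classic (VV g = c')) as [<-|Hgc'].
    { exists g. split; [reflexivity|apply dS_le_refl]. }
    destruct (geodesic_step (VV g) c') as [w [Hw Ew]]; auto.
    assert (Vw : Valid w) by apply Hw.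
    pose proof (dist_triangle c w c' Hc Vw Hc').
    pose proof (dist_triangle c (VV g) w Hc Vg Vw).
    pose proof (dist_adj _ _ Hw).
    destruct w as [h|l C].
    - destruct (IH (dist (VV h) c')) with (g := h) as [y [Hy Hd]]; auto; try lia.
      exists y. split; [exact Hy|].
      apply dS_le_mono with (1 + dist (VV h) c' * (B + 1)); [|nia].
      apply dS_le_trans with h; [|exact Hd].
      destruct Hw as [_ [_ [_ [s [Hs [->| ->]]]]]].
      + apply dS_le_letter. now left.
      + rewrite <- (gmul1r G h) at 2. rewrite <- (gmulVr G s), gmulA.
        apply dS_le_letter. right. now rewrite ginvK.
    - destruct (classic (VW l C = c')) as [<-|HCc'].
      { exists g. split; [apply Hw|apply dS_le_refl]. }
      destruct (geodesic_step (VW l C) c') as [q [Hq Eq]]; auto.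
      assert (Vq : Valid q) by apply Hq.
      pose proof (dist_triangle c q c' Hc Vq Hc').
      pose proof (dist_triangle c (VW l C) q Hc Vw Vq).
      pose proof (dist_adj _ _ Hq).
      destruct q as [h|l' C']; [|destruct Hq as [_ [_ [_ []]]]].
      destruct (IH (dist (VV h) c')) with (g := h) as [y [Hy Hd]]; auto; try lia.
      exists y. split; [exact Hy|].
      apply dS_le_mono with (B + dist (VV h) c' * (B + 1)); [|nia].
      apply dS_le_trans with h; [|exact Hd].
      destruct (detour_around_coset c c' (VV g) (VW l C) (VV h))
        as [j [Hj Hwalk]]; auto; try lia.
      apply (HB l C g h j); auto; [apply Hw|apply Hq]. }
  (* If [c] is a coset, the trace starts at the next vertex of the geodesic, which is a member of
     [c]. *)
  destruct c as [g|l C].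
  - destruct (Hgeo (dist (VV g) c') g) as [y [Hy Hd]]; auto.
    { pose proof (dist_le (VV g) (VV g) 0 (walk0 Hc)). lia. }
    exists g, y. repeat split; auto. apply dS_le_mono with (1 := Hd). nia.
  - destruct (geodesic_step (VW l C) c') as [q [Hq Eq]]; auto.
    assert (Vq : Valid q) by apply Hq.
    destruct q as [g|l' C']; [|destruct Hq as [_ [_ [_ []]]]].
    pose proof (dist_triangle _ _ _ Hc Vq Hc'). pose proof (dist_adj _ _ Hq).
    destruct (Hgeo (dist (VV g) c') g) as [y [Hy Hd]]; auto; [lia|].
    exists g, y. repeat split; [apply Hq|exact Hy|].
    apply dS_le_mono with (1 := Hd). nia.
Qed.

End Centres.

(** * Orbits of a finite subgroup and the invariant clique *)

Lemma orbit_list (F : G -> Prop) v : finite_pred G F ->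
  exists K : list (vtx G Lam), forall u, In u K <-> exists f, F f /\ u = act f v.
Proof.
  intros [L HL]. destruct (sublist_of_pred _ F L) as [L' HL'].
  exists (map (fun f => act f v) L'). intros u. rewrite in_map_iff. split.
  - intros [f [<- Hf]]. exists f. split; [now apply HL'|reflexivity].
  - intros [f [Hf ->]]. exists f. split; [reflexivity|]. apply HL'. auto.
Qed.

End ConedOff.

Theorem theorem2p5 (G : Group) (Lam : Type) (P : Lam -> G -> Prop) (S : list G)
  (HLam : exists lams : list Lam, forall l, In l lams)
  (HS : @generates G S)
  (Hrh : @rel_hyperbolic G Lam P S) :
  exists N : nat, forall n : nat, N <= n ->
    forall F : G -> Prop, @is_subgroup G F -> @finite_pred G F ->
      exists K : list (vtx G Lam), @rips_clique G Lam P S n K /\ @fixes_set G Lam F K.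
Proof.
  destruct Hrh as [HP [Hfine [delta Hdelta]]].
  destruct (angle_bound HP HS Hfine HLam (9 * (4 * delta + 1) + 4 * delta + 2))
    as [B HB].
  (* The diameter bound for centres times the cost per edge; it is fixed before [F] is
     introduced. *)
  exists ((4 * delta + 1) * (B + 1)). intros n Hn F [F1 [FM FV]] Ffin.
  set (dst := dist (P := P) (gens := S)).
  set (X := fun x : vtx G Lam => exists f, F f /\ x = VV f).
  assert (X_valid : forall x, X x -> valid P x) by (intros x [f [_ ->]]; exact I).
  assert (X_nonempty : exists x, X x) by (exists (VV gone), gone; auto).
  destruct (least_nat (fun k => exists c, valid P c /\ forall x, X x -> dst c x <= k))
    as [r [[c0 [Hc0 Xc0]] r_min]].
  { destruct Ffin as [L HL].
    destruct (uniform_bound_list G (fun f k => dst (VV gone) (VV f) <= k) L)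
      as [k Hk].
    - intros; lia.
    - intros f _. now exists (dst (VV gone) (VV f)).
    - exists k, (VV gone). split; [exact I|]. intros x [f [Hf ->]]. auto. }
  assert (r_min' : forall c k, valid P c -> (forall x, X x -> dst c x <= k) -> r <= k)
    by eauto.
  (* [F] permutes [X] and acts without increasing distances: a point [g] of [X] is compared with its
     translate by [ginv f], which is again in [X]. *)
  assert (Hcentre : forall f, F f -> centre (P := P) (gens := S) X r (act f c0)).
  { intros f Hf. split; [now apply valid_act|]. intros x [g [Hg ->]].
    rewrite <- (actKV f (VV g)).
    eapply Nat.le_trans; [apply (dist_act_le HP HS); [exact Hc0|exact I]|].
    apply Xc0. exists (gmul (ginv f) g). split; [auto|reflexivity]. }
  destruct (orbit_list F c0 Ffin) as [K HK].
  exists K. split; [split; [|split]|].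
  - assert (Hin : In (act gone c0) K) by (apply HK; eauto).
    intros ->. exact Hin.
  - intros u Hu. apply HK in Hu. destruct Hu as [f [_ ->]]. now apply valid_act.
  - intros u u' Hu Hu' Hne. apply HK in Hu, Hu'.
    destruct Hu as [f [Hf ->]], Hu' as [f' [Hf' ->]].
    repeat split; [now apply valid_act|now apply valid_act|exact Hne|].
    destruct (centre_distS_le HP HS delta Hdelta X X_nonempty X_valid r r_min'
      B (act f c0) (act f' c0)) as [x [y [Hx [Hy Hd]]]]; auto.
    exists x, y. repeat split; auto. now apply dS_le_mono with (1 := Hd).
  - intros f Hf v. rewrite !HK. split.
    + intros [g [Hg ->]]. exists (gmul f g). split; [auto|apply act_act].
    + intros [g [Hg E]]. exists (gmul (ginv f) g). split; [auto|].
      now rewrite <- act_act, <- E, actK.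
Qed.
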